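(* Let $(N,\Sigma,\beta)$ be a stacky fan and $G=\mathrm{Hom}_{\mathbb{Z}}(\mathrm{DG}(\beta),\mathbb{T})$. If $G_0\subset G$ denotes the connected component of the identity element, then $G/G_0\cong\mathrm{coker}\,\beta$. In particular, $G$ is connected if and only if $\beta$ is surjective.
   Context: Notation: $\mathbb{T}=\mathbb{C}^\times$; $(-)^\star=\mathrm{Hom}_{\mathbb{Z}}(-,\mathbb{Z})$; $e_1,\dots,e_n$ is the standard basis of $\mathbb{Z}^n$. A stacky fan $(N,\Sigma,\beta)$ consists of a finitely generated abelian group $N$ of rank $d$, a rational simplicial fan $\Sigma$ in $N\otimes\mathbb{R}$ with rays $\rho_1,\ldots,\rho_n$, and a homomorphism $\beta:\mathbb{Z}^n\to N$ such that the rays span $N\otimes\mathbb{R}$ and, for each $j$, $\beta(e_j)\otimes 1$ lies on (and generates) $\rho_j$. (In particular $\mathrm{coker}\,\beta$ is finite.) The dual group: choose a free resolution $0\to\mathbb{Z}^\ell\xrightarrow{Q}\mathbb{Z}^{d+\ell}\to N\to 0$ and a lift $B:\mathbb{Z}^n\to\mathbb{Z}^{d+\ell}$ of $\beta$; let $[B\,Q]:\mathbb{Z}^n\oplus\mathbb{Z}^\ell\to\mathbb{Z}^{d+\ell}$ be the map restricting to $B$ and $Q$ on the summands, and set $\mathrm{DG}(\beta)=(\mathbb{Z}^{n+\ell})^\star/\mathrm{im}\,[B\,Q]^\star$. *)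

(* Defs.v *)
From HB Require Import structures.
From mathcomp Require Import all_boot all_order all_algebra.
From mathcomp Require Import generic_quotient ring_quotient.
From mathcomp Require Import all_classical all_reals all_analysis.
From mathcomp Require Import complex freeg.

Set Implicit Arguments.
Unset Strict Implicit.
Unset Printing Implicit Defensive.

Import Order.TTheory GRing.Theory Num.Theory numFieldNormedType.Exports.
Local Open Scope classical_set_scope.
Local Open Scope ring_scope.
Local Open Scope quotient_scope.

(* Abelian groups are [zmodType]s throughout, hence written additively; this
   includes C^* and the groups of homomorphisms into it. *)

Section Cokernel.
Variables (A B : zmodType) (f : {additive A -> B}).

Definition im_pred : {pred B} := fun y => `[< exists x, f x = y >].

Lemma im_pred_zmod_closed : zmod_closed im_pred.
Proof.
split; first by apply/asboolP; exists 0; rewrite raddf0.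
move=> u v /asboolP[x <-] /asboolP[y <-].
by apply/asboolP; exists (x - y); rewrite raddfB.
Qed.

HB.instance Definition _ :=
  GRing.isZmodClosed.Build B im_pred im_pred_zmod_closed.

Definition coker : zmodType := {ideal_quot im_pred}.

End Cokernel.

Definition zmod_isog (A B : zmodType) : Prop :=
  exists f : {additive A -> B}, bijective f.

Section HomZ.
Variables A B : zmodType.

Definition HomZ : Type := {additive A -> B}.

HB.instance Definition _ := gen_eqMixin HomZ.
HB.instance Definition _ := gen_choiceMixin HomZ.

Lemma HomZP (f g : HomZ) : (f : A -> B) =1 g -> f = g.
Proof.
case: f g => [f [[fP]]] [g [[gP]]] /= /funext fg.
by rewrite -{}fg in gP *; rewrite (Prop_irrelevance fP gP).
Qed.

Definition HomZ0 : HomZ := \0 : {additive A -> B}.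
Definition HomZ_add (f g : HomZ) : HomZ := f \+ g : {additive A -> B}.
Definition HomZ_opp (f : HomZ) : HomZ := \- f : {additive A -> B}.

Fact HomZ_addA : associative HomZ_add.
Proof. by move=> f g h; apply: HomZP => x; apply: addrA. Qed.
Fact HomZ_addC : commutative HomZ_add.
Proof. by move=> f g; apply: HomZP => x; apply: addrC. Qed.
Fact HomZ_add0 : left_id HomZ0 HomZ_add.
Proof. by move=> f; apply: HomZP => x; apply: add0r. Qed.
Fact HomZ_addN : left_inverse HomZ0 HomZ_opp HomZ_add.
Proof. by move=> f; apply: HomZP => x; apply: addNr. Qed.

HB.instance Definition _ :=
  GRing.isZmodule.Build HomZ HomZ_addA HomZ_addC HomZ_add0 HomZ_addN.

End HomZ.

Section Dual.
Variables (A B : zmodType) (f : {additive A -> B}).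

Definition dual_map (u : HomZ B int) : HomZ A int := u \o f : {additive A -> int}.

Fact dual_map_is_zmod_morphism : zmod_morphism dual_map.
Proof. by move=> u v; apply: HomZP. Qed.

HB.instance Definition _ :=
  GRing.isZmodMorphism.Build (HomZ B int) (HomZ A int) dual_map
    dual_map_is_zmod_morphism.

End Dual.

(* HomZ A B carries the topology of pointwise convergence. *)
Section HomTopology.
Variables (A : zmodType) (B : topologicalZmodType).

HB.instance Definition _ := Topological.copy (HomZ A B)
  (initial_topology (fun f : HomZ A B => (f : A -> B) : {ptws A -> B})).

Lemma HomZ_eval_continuous (a : A) : continuous (fun f : HomZ A B => f a).
Proof.
move=> f; apply: (@continuous_comp (HomZ A B) {ptws A -> B} B
  (fun f => (f : A -> B)) (fun g => g a)).
  exact: initial_continuous.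
exact: (@proj_continuous A (fun=> B) a).
Qed.

Fact HomZ_sub_continuous :
  continuous (fun x : HomZ A B * HomZ A B => x.1 - x.2).
Proof.
apply: continuous_comp_initial => x.
have FF : Filter ((fun y : HomZ A B * HomZ A B => (y.1 - y.2 : A -> B)) @ x).
  exact: fmap_filter.
apply/cvg_sup => a; move: x {FF}.
apply/(@continuousP _ (initial_topology (@^~ a))) => _ [C oC <-].
suff /continuousP : continuous (fun y : HomZ A B * HomZ A B => y.1 a - y.2 a).
  exact.
move=> y; apply: (@continuous_comp _ _ _
  (fun y : HomZ A B * HomZ A B => (y.1 a, y.2 a)) (fun z : B * B => z.1 - z.2)).
  apply: cvg_pair.
    apply: (@continuous_comp _ _ _ fst (fun f : HomZ A B => f a)).
      exact: cvg_fst.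
    exact: HomZ_eval_continuous.
  apply: (@continuous_comp _ _ _ snd (fun f : HomZ A B => f a)).
    exact: cvg_snd.
  exact: HomZ_eval_continuous.
exact: sub_continuous.
Qed.

HB.instance Definition _ :=
  PreTopologicalNmodule_isTopologicalZmodule.Build (HomZ A B)
    HomZ_sub_continuous.

End HomTopology.

Section IdentityComponent.
Variable G : topologicalZmodType.

Definition id_component : {pred G} :=
  fun x => `[< connected_component [set: G] 0 x >].

Lemma id_component_zmod_closed : zmod_closed id_component.
Proof.
split; first by apply/asboolP; exact: connected_component_refl.
move=> x y /asboolP Gx /asboolP Gy; apply/asboolP.
pose t z : G := z - y.
have ct : continuous t.
  move=> z; apply: (@continuous_comp _ _ _
    (fun z : G => (z, y)) (fun p : G * G => p.1 - p.2)).
    by apply: cvg_pair; [exact: cvg_id|exact: cvg_cst].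
  exact: sub_continuous.
have tC : connected (t @` connected_component [set: G] 0).
  apply: connected_continuous_connected; first exact: component_connected.
  exact: continuous_subspaceT.
have t0 : (t @` connected_component [set: G] 0) 0.
  by exists y => //; rewrite /t subrr.
have /(_ (x - y)) := @connected_component_max G setT _ 0 t0 (@subsetT _ _) tC.
by apply; exists x.
Qed.

HB.instance Definition _ :=
  GRing.isZmodClosed.Build G id_component id_component_zmod_closed.

Definition component_group : zmodType := {ideal_quot id_component}.

End IdentityComponent.

(* The group C^*; its group law is the product of complex numbers and its
   topology is induced from C. *)
Section Cstar.
Variable R : realType.

Record Cstar := MkCstar { cstar_val : R[i]; _ : cstar_val != 0 }.

HB.instance Definition _ := [isSub for cstar_val].
HB.instance Definition _ := [Choice of Cstar by <:].

Definition cstar_one : Cstar := MkCstar (oner_neq0 R[i]).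
Definition cstar_mul (z w : Cstar) : Cstar :=
  MkCstar (mulf_neq0 (valP z) (valP w)).
Fact cstar_inv_neq0 (z : Cstar) : (val z)^-1 != 0.
Proof. exact: (invr_neq0 (valP z)). Qed.
Definition cstar_inv (z : Cstar) : Cstar := MkCstar (cstar_inv_neq0 z).

Fact cstar_mulA : associative cstar_mul.
Proof. by move=> x y z; apply: val_inj; exact: mulrA. Qed.
Fact cstar_mulC : commutative cstar_mul.
Proof. by move=> x y; apply: val_inj; exact: mulrC. Qed.
Fact cstar_mul1 : left_id cstar_one cstar_mul.
Proof. by move=> x; apply: val_inj; exact: mul1r. Qed.
Fact cstar_mulV : left_inverse cstar_one cstar_inv cstar_mul.
Proof. by move=> x; apply: val_inj; exact: (mulVf (valP x)). Qed.

HB.instance Definition _ :=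
  GRing.isZmodule.Build Cstar cstar_mulA cstar_mulC cstar_mul1 cstar_mulV.

HB.instance Definition _ := Topological.copy Cstar
  (initial_topology (cstar_val : Cstar -> (R[i])^o)).

Lemma cstar_val_continuous : continuous (cstar_val : Cstar -> (R[i])^o).
Proof. exact: initial_continuous. Qed.

Fact Cstar_sub_continuous : continuous (fun x : Cstar * Cstar => x.1 - x.2).
Proof.
apply: continuous_comp_initial => x.
have c1 : continuous_at x (fun y : Cstar * Cstar => cstar_val y.1 : (R[i])^o).
  apply: (@continuous_comp _ _ _ fst (cstar_val : Cstar -> (R[i])^o)).
    exact: cvg_fst.
  exact: cstar_val_continuous.
have c2 : continuous_at x (fun y : Cstar * Cstar => cstar_val y.2 : (R[i])^o).
  apply: (@continuous_comp _ _ _ snd (cstar_val : Cstar -> (R[i])^o)).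
    exact: cvg_snd.
  exact: cstar_val_continuous.
apply: (@cvgM (R[i] : numFieldType) _ _ _ _ _ _ _ c1).
by apply: cvgV; [exact: (valP x.2)|exact: c2].
Qed.

HB.instance Definition _ :=
  PreTopologicalNmodule_isTopologicalZmodule.Build Cstar Cstar_sub_continuous.

End Cstar.

(* N (x) R, as the quotient of the free R-module on N by the R-submodule
   generated by the elements [a + b] - [a] - [b]. *)
Section RealExtension.
Variables (R : realType) (N : zmodType).
Local Notation free := {freeg N / R}.

Definition tensor_rel : {pred free} := fun D => `[< exists k
  (c : 'I_k -> R) (a b : 'I_k -> N),
  D = \sum_i c i *: (<< a i + b i >> - << a i >> - << b i >>) >].

Lemma tensor_rel_submod_closed : submod_closed tensor_rel.
Proof.
split; first by apply/asboolP; exists 0%N, (fun=> 0), (fun=> 0), (fun=> 0);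
  rewrite big_ord0.
move=> r _ _ /asboolP[k [c [a [b ->]]]] /asboolP[k' [c' [a' [b' ->]]]].
pose glue T (f : 'I_k -> T) (f' : 'I_k' -> T) (i : 'I_(k + k')) : T :=
  match fintype.split i with inl j => f j | inr j => f' j end.
apply/asboolP; exists (k + k')%N, (glue _ (fun i => r * c i) c'),
  (glue _ a a'), (glue _ b b').
rewrite big_split_ord scaler_sumr /=; congr (_ + _); apply: eq_bigr => i _.
  by rewrite /glue (unsplitK (inl i)) scalerA.
by rewrite /glue (unsplitK (inr i)).
Qed.

HB.instance Definition _ :=
  GRing.isSubmodClosed.Build R free tensor_rel
    (GRing.submod_closed_semi tensor_rel_submod_closed).

Definition realext : Type := {ideal_quot tensor_rel}.

HB.instance Definition _ := GRing.Zmodule.on realext.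

Definition realext_pi (D : free) : realext := \pi_({ideal_quot tensor_rel}) D.
Definition realext_scale (r : R) (x : realext) : realext :=
  realext_pi (r *: repr (x : {ideal_quot tensor_rel})).

Lemma realext_pi_eq (D E : free) :
  realext_pi D = realext_pi E <-> D - E \in tensor_rel.
Proof. by rewrite Quotient.idealrBE; split=> [/eqP|/eqP]. Qed.

Lemma realext_pi_is_zmod_morphism : zmod_morphism realext_pi.
Proof. exact: raddfB. Qed.

HB.instance Definition _ :=
  GRing.isZmodMorphism.Build free realext realext_pi
    realext_pi_is_zmod_morphism.

Lemma realext_piZ (r : R) (D : free) :
  realext_scale r (realext_pi D) = realext_pi (r *: D).
Proof.
apply/realext_pi_eq; rewrite -scalerBr; apply: rpredZ.
by apply/realext_pi_eq; exact: reprK.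
Qed.

Lemma realext_ind (P : realext -> Prop) :
  (forall D, P (realext_pi D)) -> forall x, P x.
Proof.
by move=> H x; rewrite -[x](@reprK _ {ideal_quot tensor_rel}); exact: H.
Qed.

Fact realext_scaleA r s x :
  realext_scale r (realext_scale s x) = realext_scale (r * s) x.
Proof. by elim/realext_ind: x => D; rewrite !realext_piZ scalerA. Qed.
Fact realext_scale1 : left_id 1 realext_scale.
Proof. by elim/realext_ind => D; rewrite realext_piZ scale1r. Qed.
Fact realext_scaleDr : right_distributive realext_scale +%R.
Proof.
move=> r; elim/realext_ind => D; elim/realext_ind => E.
by rewrite -raddfD !realext_piZ scalerDr raddfD.
Qed.
Fact realext_scaleDl x : {morph realext_scale^~ x : r s / r + s}.
Proof.
move=> r s; elim/realext_ind: x => D.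
by rewrite !realext_piZ scalerDl raddfD.
Qed.

HB.instance Definition _ := GRing.Zmodule_isLmodule.Build R realext
  realext_scaleA realext_scale1 realext_scaleDr realext_scaleDl.

(* a (x) 1 *)
Definition tens1 (a : N) : realext := realext_pi << a >>.

Fact tens1_is_zmod_morphism : zmod_morphism tens1.
Proof.
suff tens1D : {morph tens1 : a b / a + b}.
  by move=> a b; rewrite -[X in _ = tens1 X - _](subrK b a) (tens1D (a - b)) addrK.
move=> a b; rewrite /tens1 -raddfD; apply/realext_pi_eq.
apply/asboolP; exists 1%N, (fun=> 1), (fun=> a), (fun=> b).
by rewrite big_ord1 scale1r opprD addrA.
Qed.

HB.instance Definition _ :=
  GRing.isZmodMorphism.Build N realext tens1 tens1_is_zmod_morphism.

End RealExtension.

Section Cones.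
Variables (R : realType) (V : lmodType R).

Definition lin_span (A : set V) : set V :=
  [set x | exists k (c : 'I_k -> R) (v : 'I_k -> V),
    (forall i, A (v i)) /\ x = \sum_i c i *: v i].

Definition lin_indep k (v : 'I_k -> V) : Prop :=
  forall c : 'I_k -> R, \sum_i c i *: v i = 0 -> forall i, c i = 0.

Definition cone k (v : 'I_k -> V) : set V :=
  [set x | exists c : 'I_k -> R,
    (forall i, 0 <= c i) /\ x = \sum_i c i *: v i].

Definition strongly_convex (s : set V) : Prop :=
  forall x, s x -> s (- x) -> x = 0.

Definition simplicial_cone (s : set V) : Prop :=
  exists k (v : 'I_k -> V), lin_indep v /\ s = cone v.

Definition face (t s : set V) : Prop :=
  exists u : {scalar V}, (forall x, s x -> 0 <= u x) /\
    t = s `&` [set x | u x = 0].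

Definition half_line (v : V) : set V := [set r *: v | r in [set r : R | 0 <= r]].

Definition is_ray (s : set V) : Prop := exists v, v != 0 /\ s = half_line v.

End Cones.

Section Fans.
Variables (R : realType) (N : zmodType).
Local Notation NR := (realext R N).

Definition rational_cone (s : set NR) : Prop :=
  exists k (a : 'I_k -> N), s = cone (fun i => tens1 R (a i)).

Record rational_simplicial_fan (Sigma : set (set NR)) : Prop := {
  fan_finite : finite_set Sigma;
  fan_rational s : Sigma s -> rational_cone s;
  fan_strongly_convex s : Sigma s -> strongly_convex s;
  fan_simplicial s : Sigma s -> simplicial_cone s;
  fan_face s t : Sigma s -> face t s -> Sigma t;
  fan_meet s t : Sigma s -> Sigma t ->
    face (s `&` t) s /\ face (s `&` t) t }.

Definition finitely_generated : Prop :=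
  exists k (g : 'I_k -> N), forall x, exists c : 'I_k -> int,
    x = \sum_i g i *~ c i.

Definition z_indep k (a : 'I_k -> N) : Prop :=
  forall c : 'I_k -> int, \sum_i a i *~ c i = 0 -> forall i, c i = 0.

Definition has_rank (d : nat) : Prop :=
  (exists a : 'I_d -> N, z_indep a) /\
  (forall k (a : 'I_k -> N), z_indep a -> (k <= d)%N).

Definition std_basis n (j : 'I_n) : 'cV[int]_n := delta_mx j 0.

Record stacky_fan (d n : nat) (Sigma : set (set NR)) (rho : 'I_n -> set NR)
    (beta : {additive 'cV[int]_n -> N}) : Prop := {
  stacky_fg : finitely_generated;
  stacky_rank : has_rank d;
  stacky_is_fan : rational_simplicial_fan Sigma;
  stacky_rays_inj : injective rho;
  stacky_rays s : (Sigma s /\ is_ray s) <-> exists j, s = rho j;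
  stacky_span : lin_span (\bigcup_j rho j) = setT;
  stacky_beta j : rho j = half_line (tens1 R (beta (std_basis j))) }.

End Fans.

Section DualGroup.
Variables (N : zmodType) (n m l : nat).

(* exactness of 0 -> Z^l -Q-> Z^m -p-> N -> 0 *)
Record free_resolution (Q : {additive 'cV[int]_l -> 'cV[int]_m})
    (p : {additive 'cV[int]_m -> N}) : Prop := {
  resolution_inj : injective Q;
  resolution_exact x : p x = 0 <-> exists y, Q y = x;
  resolution_surj a : exists x, p x = a }.

Variables (B : {additive 'cV[int]_n -> 'cV[int]_m}).
Variables (Q : {additive 'cV[int]_l -> 'cV[int]_m}).

Definition BQ (v : 'cV[int]_(n + l)) : 'cV[int]_m :=
  B (usubmx v) + Q (dsubmx v).

Fact BQ_is_zmod_morphism : zmod_morphism BQ.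
Proof. by move=> u v; rewrite /BQ !linearB /= !raddfB addrACA -opprD. Qed.

HB.instance Definition _ :=
  GRing.isZmodMorphism.Build 'cV[int]_(n + l) 'cV[int]_m BQ BQ_is_zmod_morphism.

Definition DG : zmodType := coker (dual_map BQ).

End DualGroup.

(* Main.v *)
Require Import Defs.
From HB Require Import structures.
From mathcomp Require Import all_boot all_order all_algebra.
From mathcomp Require Import generic_quotient ring_quotient.
From mathcomp Require Import all_classical all_reals all_analysis.
From mathcomp Require Import ring lra complex freeg.

(** Write M for the integer matrix of [B Q] : Z^(n+l) -> Z^(d+l).  A character
    of DG(beta) is a character chi of the group of integer row vectors that is
    trivial on the rows of M.  Since z |-> exp (2 i pi z) maps C onto C^* with
    kernel Z (lemmas Exp_surj and Exp_eq0), such a chi is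
    y |-> exp (2 i pi y z) for a complex column z, unique up to an integer
    column, and triviality on the rows of M says that M z is integral.  So
    chi |-> [M z] is a well-defined homomorphism from G to coker M, which the
    resolution identifies with coker beta (coker_BQ_isog).

    The rays spanning N (x) R means that no nonzero integer functional on N
    vanishes on the image of beta (span_separates), hence that the rows of M
    are linearly independent (BQ_full_row_rank).  Then M is surjective over R,
    and chi |-> [M z] is onto coker M (component_map_surj).

    Its kernel is the identity component.  If M z = M c with c integral, then
    z - c is another logarithm of chi and is annihilated by M, so
    t |-> exp (2 i pi t (z - c)) is a path from 1 to chi inside G
    (component_map_ker).  Conversely, let chi lie in the identity component,
    and let x be a torsion class of DG(beta): a row with e x = y M.  Evaluation
    at x maps the connected set G_0 to the finite set of e-th roots of unity,
    so chi(x) = 1, which reads e | y (M z).  By the Smith normal form of M,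
    these divisibilities characterize the image of M (mulmx_int_image), so
    [M z] = 0 (id_component_ker).

    A group is connected exactly when its component group is trivial, which
    gives the last assertion. *)

Set Implicit Arguments.
Unset Strict Implicit.
Unset Printing Implicit Defensive.

Import Order.TTheory GRing.Theory Num.Theory numFieldNormedType.Exports.
Local Open Scope classical_set_scope.
Local Open Scope ring_scope.
Local Open Scope quotient_scope.

(** * Quotients and component groups *)

Section Quotients.
Variables (X Y : zmodType) (S : zmodClosed X).

Lemma quot_eq0 (x : X) : \pi_({ideal_quot S}) x = 0 <-> x \in S.
Proof.
have p0 : \pi_({ideal_quot S}) 0 = 0 by exact: raddf0.
by rewrite -{1}p0 -{2}(subr0 x) Quotient.idealrBE; split => /eqP.
Qed.

Lemma quot_lift (g : {additive X -> Y}) : (forall x, x \in S -> g x = 0) ->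
  exists h : {additive {ideal_quot S} -> Y}, forall x, h (\pi_({ideal_quot S}) x) = g x.
Proof.
move=> gS; pose h (q : {ideal_quot S}) := g (repr q).
have hE x : h (\pi x) = g x.
  apply/eqP; rewrite -subr_eq0 -raddfB; apply/eqP/gS/quot_eq0.
  by rewrite raddfB /= reprK subrr.
have hB : zmod_morphism h.
  move=> p q; rewrite -[p]reprK -[q]reprK -raddfB.
  by rewrite /= !hE (raddfB g).
pose H := GRing.isZmodMorphism.Build _ _ h hB.
pose h' : {additive {ideal_quot S} -> Y} := HB.pack h H.
by exists h'.
Qed.

(** First isomorphism theorem; the inverse is obtained by choosing preimages
    under g. *)
Lemma quot_isog (g : {additive X -> Y}) :
    (forall y, exists x, g x = y) -> (forall x, g x = 0 <-> x \in S) ->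
  zmod_isog {ideal_quot S} Y.
Proof.
move=> /choice[s gs] gker.
have [h hE] := quot_lift (fun x => (gker x).2).
exists h, (fun y => \pi_({ideal_quot S}) (s y)) => [q|y]; last by rewrite hE.
rewrite -[q]reprK hE; apply/eqP; rewrite -subr_eq0 -raddfB; apply/eqP/quot_eq0/gker.
by rewrite raddfB /= gs subrr.
Qed.

End Quotients.

Lemma zmod_isog_trans (X Y Z : zmodType) :
  zmod_isog X Y -> zmod_isog Y Z -> zmod_isog X Z.
Proof. by move=> [f bf] [g bg]; exists (g \o f); exact: bij_comp. Qed.

Lemma connected_component_group (G : topologicalZmodType) :
  connected [set: G] <-> (forall c : component_group G, c = 0).
Proof.
split=> [cG c|c0].
  rewrite -[c](@reprK _ {ideal_quot @id_component G}).
  by apply/quot_eq0/asboolP; rewrite connected_component_id.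
rewrite (_ : setT = connected_component [set: G] 0); first exact: component_connected.
apply/esym/seteqP; split=> // x _.
exact/asboolP/(quot_eq0 (@id_component G) x).1/c0.
Qed.

Lemma coker_eq0 (A B : zmodType) (f : {additive A -> B}) :
  (forall c : coker f, c = 0) <-> (forall b, exists a, f a = b).
Proof.
split=> [c0 b|fs c].
  by apply/asboolP/(quot_eq0 (im_pred f) b).1/c0.
rewrite -[c](@reprK _ {ideal_quot im_pred f}).
by apply/quot_eq0/asboolP/fs.
Qed.

Lemma zmod_isog_eq0 (A B : zmodType) : zmod_isog A B ->
  (forall a : A, a = 0) <-> (forall b : B, b = 0).
Proof.
move=> [g [h gK hK]]; split=> [a0 b|b0 a].
  by rewrite -[b]hK (a0 (h b)) raddf0.
by rewrite -[a]gK (b0 (g a)) -(raddf0 g) gK.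
Qed.

(** * The exponential of the multiplicative group *)

Section Exponential.
Local Open Scope complex_scope.
Variable R : realType.

(** A logarithm is kept as a pair of reals, with its imaginary part in units of
    2 pi: z stands for exp (z.1 + 2 i pi z.2).  The periods are then the pairs
    (0, n) with n integral, so that integrality conditions only concern the
    second component. *)
Definition cexp (z : R * R) : R[i] :=
  (expR z.1 * cos (pi *+ 2 * z.2)) +i* (expR z.1 * sin (pi *+ 2 * z.2)).

Fact cexp_neq0 z : cexp z != 0.
Proof.
apply/eqP => -[] /eqP c0 /eqP s0; have := cos2Dsin2 (pi *+ 2 * z.2).
move: c0 s0; rewrite !mulf_eq0 !(gt_eqF (expR_gt0 _)) /= => /eqP -> /eqP ->.
by move/eqP; rewrite !expr0n /= addr0 eq_sym oner_eq0.
Qed.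

Definition Exp z : Cstar R := MkCstar (cexp_neq0 z).

Fact ExpB : zmod_morphism Exp.
Proof.
suff ExpD : {morph Exp : x y / x + y}.
  by move=> x y; rewrite -[X in _ = Exp X - _](subrK y x) (ExpD (x - y)) addrK.
move=> [a b] [c d]; apply: val_inj => /=.
rewrite /cexp /=; simpc; rewrite mulrDr expRD cosD sinD.
congr (_ +i* _); ring.
Qed.

HB.instance Definition _ := GRing.isZmodMorphism.Build (R * R)%type (Cstar R) Exp ExpB.

Lemma Exp_surj u : exists z, Exp z = u.
Proof.
case: u => -[x y] u0.
pose r := Num.sqrt (x ^+ 2 + y ^+ 2).
have r2 : 0 < x ^+ 2 + y ^+ 2.
  rewrite lt_neqAle addr_ge0 ?sqr_ge0 // andbT eq_sym paddr_eq0 ?sqr_ge0 //.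
  rewrite !sqrf_eq0; apply: contra u0 => /andP[/eqP-> /eqP->] //.
have r0 : 0 < r by rewrite sqrtr_gt0.
have rE : r ^+ 2 = x ^+ 2 + y ^+ 2 by rewrite sqr_sqrtr // ltW.
suff [t xE yE] : exists2 t, x = r * cos t & y = r * sin t.
  exists (ln r, t / (pi *+ 2)); apply: val_inj; rewrite /= /cexp /= lnK //.
  rewrite mulrCA divff ?mulr1 ?xE ?yE //.
  by rewrite mulrn_eq0 /= gt_eqF ?pi_gt0.
have xr1 : -1 <= x / r <= 1.
  rewrite -ler_norml normrM normfV (gtr0_norm r0) ler_pdivrMr // mul1r.
  rewrite -(@ler_pXn2r _ 2) ?nnegrE // ?(ltW r0) // rE real_normK ?num_real //.
  by rewrite lerDl sqr_ge0.
have cE : r * cos (acos (x / r)) = x by rewrite acosK // mulrC divfK ?gt_eqF.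
have sE : r * sin (acos (x / r)) = `|y|.
  rewrite sin_acos // -{1}(gtr0_norm r0) -sqrtr_sqr -sqrtrM ?sqr_ge0 //.
  rewrite mulrBr mulr1 -exprMn mulrC divfK ?gt_eqF //.
  by rewrite rE (addrC (x ^+ 2)) addrK sqrtr_sqr.
have [y0|y0] := leP 0 y.
- by exists (acos (x / r)); rewrite ?cE // sE ger0_norm.
- by exists (- acos (x / r)); rewrite ?cosN ?sinN ?mulrN ?cE // sE ltr0_norm ?opprK.
Qed.

(** Subtracting an integer reduces to 0 <= z.2 < 1, where the half-angle
    formula turns cos (2 pi z.2) = 1 into sin (pi z.2) = 0. *)
Lemma Exp_eq0 z : Exp z = 0 <-> z.1 = 0 /\ z.2 \is a Num.int.
Proof.
have Exp01 : Exp (0, 1) = 0.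
  apply: val_inj; rewrite /= /cexp /= mulr1 cos2pi sin2pi expR0 mul1r mulr0.
  by [].
have Expz (c : int) : Exp (0, c%:~R) = 0.
  have -> : (0, c%:~R) = (0, 1) *~ c :> R * R.
    by rewrite [RHS]surjective_pairing !raddfMz /= mul0rz.
  by rewrite raddfMz [X in X *~ _]Exp01 mul0rz.
split=> [|]; last by case: z => a b /= [-> /intrP[c ->]].
case: z => a b Eab0 /=.
(* r is the representative of b modulo Z in [0, 1[. *)
pose r := b - (Num.floor b)%:~R.
have Ear0 : Exp (a, r) = 0.
  have -> : (a, r) = (a, b) - (0, (Num.floor b)%:~R).
    by rewrite [RHS]surjective_pairing !raddfB /= subr0.
  by rewrite raddfB /= Eab0 Expz subr0.
have r_ge0 : 0 <= r by rewrite subr_ge0 floor_le.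
have r_lt1 : r < 1 by rewrite ltrBlDl -[1]/1%:~R -intrD floorD1_gt.
case: (congr1 val Ear0); rewrite /= => c1 s0.
have {}s0 : sin (pi *+ 2 * r) = 0.
  by move/eqP: s0; rewrite mulf_eq0 gt_eqF ?expR_gt0 //= => /eqP.
have c1' : cos (pi *+ 2 * r) = 1.
  have := cos2Dsin2 (pi *+ 2 * r); rewrite s0 expr0n addr0 => /eqP.
  rewrite sqrf_eq1 => /orP[/eqP //|/eqP cN1]; move: c1; rewrite cN1.
  by have := expR_gt0 a; lra.
have a0 : a = 0 by apply: expR_inj; rewrite expR0 -c1 c1' mulr1.
split=> //; suff r0 : r = 0.
  by apply/intrP; exists (Num.floor b); apply/eqP; rewrite -subr_eq0 -/r r0.
apply/eqP; rewrite eq_le r_ge0 andbT leNgt; apply/negP => r_gt0.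
have : 0 < sin (pi * r).
  by rewrite sin_gt0_pi // mulr_gt0 ?pi_gt0 //= gtr_pMr ?pi_gt0.
move: c1'; rewrite mulrnAl cos_mulr2n cos2sin2 => c1' sr.
suff : 0 < sin (pi * r) ^+ 2 by lra.
exact: exprn_gt0.
Qed.

Lemma real_complex_continuous : continuous (fun x : R => x%:C : (R[i])^o).
Proof.
move=> x; apply/(@cvgrPdist_lt _ (R[i])^o) => e; rewrite ltcE /= => /andP[/eqP e1 e2].
near=> y.
rewrite -[_ - _](raddfB (real_complex R)) normc_def /= expr0n addr0 sqrtr_sqr.
rewrite (complexE e) e1 mulr0 addr0 ltcR.
by near: y; apply: (@cvgr_dist_lt _ R^o _ _ _ idfun x) => //.
Unshelve. all: by end_near. Qed.

Lemma Exp_path_continuous z : continuous (fun t : R => Exp (t * z.1, t * z.2)).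
Proof.
apply: continuous_comp_initial.
have -> : @cstar_val R \o (fun t : R => Exp (t * z.1, t * z.2)) =
  (fun t : R => (expR (t * z.1) * cos (pi *+ 2 * (t * z.2)))%:C +
   (Complex 0 1) * (expR (t * z.1) * sin (pi *+ 2 * (t * z.2)))%:C).
  by apply/funext => t; rewrite /= [LHS]complexE.
move=> t.
have ce : (fun t => expR (t * z.1)) x @[x --> t] --> expR (t * z.1).
  by apply: continuous_comp; [exact: mulrr_continuous|exact: continuous_expR].
have ca : (fun t => pi *+ 2 * (t * z.2)) x @[x --> t] --> pi *+ 2 * (t * z.2).
  by apply: cvgM; [exact: cvg_cst|exact: mulrr_continuous].
apply: (@cvgD R[i] (R[i])^o); last apply: (@cvgM R[i]); first 2 last.
- apply: continuous_comp; last exact: real_complex_continuous.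
  apply: cvgM => //; apply: continuous_comp => //; exact: continuous_sin.
- apply: continuous_comp; last exact: real_complex_continuous.
  apply: cvgM => //; apply: continuous_comp => //; exact: continuous_cos.
- exact: cvg_cst.
Qed.
End Exponential.

(** * Connected sets of roots of unity *)

(** A finite subset of an accessible space is discrete, so its connected subsets
    have at most one point. *)
Lemma connected_finite_subset (T : topologicalType) (A B : set T) x y :
  accessible_space T -> connected A -> finite_set B -> A `<=` B -> A x -> A y -> x = y.
Proof.
move=> aT cA finB AB Ax Ay.
suff A1 : [set x] = A by move: Ay; rewrite -A1.
have fin C : C `<=` A -> closed C.
  move=> CA; apply: (proj1 accessible_finite_set_closed aT).
  by apply: sub_finite_set finB; exact: subset_trans AB.
apply: cA; first by exists x.
  exists (~` (A `\ x)).
    by rewrite openC; apply: fin; exact: subDsetl.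
  rewrite setDE setCI setCK setIUr setICr set0U.
  by apply/seteqP; split => [_ ->|z []].
exists [set x]; first by apply: fin => _ ->.
by apply/seteqP; split => [_ ->|z []].
Qed.

Section Torsion.
Variable R : realType.

Lemma val_Cstar_mulrn (u : Cstar R) n : val (u *+ n) = val u ^+ n.
Proof. by elim: n => // n IHn; rewrite mulrS exprS -IHn. Qed.

(** The e-torsion of C^* is contained in the finite set of roots of
    'X^e - 1, hence is totally disconnected. *)
Lemma connected_torsion_Cstar (A : set (Cstar R)) e (u : Cstar R) :
    (0 < e)%N -> connected A -> A 0 -> A u -> (forall v, A v -> v *+ e = 0) ->
  u = 0.
Proof.
move=> e0 cA A0 Au Ae; apply: val_inj.
have [r rE] := @closed_field_poly_normal R[i] ('X^e - 1).
apply: (@connected_finite_subset (R[i])^o (@cstar_val R @` A) [set` r]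
  (cstar_val u) (cstar_val 0)).
- exact/hausdorff_accessible/norm_hausdorff.
- apply: connected_continuous_connected => //.
  exact/continuous_subspaceT/cstar_val_continuous.
- exact: finite_seq.
- move=> _ [v Av <-] /=.
  have : root ('X^e - 1) (cstar_val v).
    by rewrite rootE !hornerE -[_ ^+ _](val_Cstar_mulrn) Ae // subrr.
  by rewrite rE lead_coefXnsubC // scale1r root_prod_XsubC.
- by exists u.
- by exists 0.
Qed.
End Torsion.

(** * Integer matrices of full row rank *)

(** Smith normal form, in which linear independence of the rows makes all m
    diagonal entries exist and be nonzero.  The rectangular diagonal factor is
    split into the square matrix diag_mx c and a matrix S with a right inverse,
    so that solving M x = w comes down to dividing the entries of L w by those
    of c. *)
Lemma smith_full_row_rank m k (M : 'M[int]_(m, k)) :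
    (forall y : 'rV_m, y *m M = 0 -> y = 0) ->
  exists (L : 'M[int]_m) (c : 'rV[int]_m) (S : 'M[int]_(m, k)) (T : 'M[int]_(k, m)),
    [/\ L \in unitmx, forall i, c 0 i != 0, L *m M = diag_mx c *m S
      & S *m T = 1%:M].
Proof.
move=> Minj; have [L uL [P uP [d _ defM]]] := int_Smith_normal_form M.
pose D : 'M[int]_(m, k) := \matrix_(i, j) (d`_i *+ (i == j :> nat)).
have LMP : invmx L *m M *m invmx P = D by rewrite defM !mulmxA mulVmx // mul1mx mulmxK.
have Dn0 i : exists j : 'I_k, D i j != 0.
  apply/existsP; rewrite -[X in is_true X]negbK negb_exists; apply/negP => /forallP Di0.
  have : delta_mx 0 i *m invmx L = 0 :> 'rV_m.
    apply: Minj; rewrite -[RHS](mul0mx _ P) -[LHS](mulmxKV uP); congr (_ *m P).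
    rewrite -!mulmxA (mulmxA (invmx L)) LMP -rowE.
    by apply/rowP => j; rewrite !mxE; have := Di0 j; rewrite negbK mxE => /eqP.
  move/(congr1 (fun A => A *m L)); rewrite mulmxKV // mul0mx => /matrixP/(_ 0 i).
  by rewrite !mxE !eqxx.
have cn0 (i : 'I_m) : (i < k)%N /\ d`_i != 0.
  have [j] := Dn0 i; rewrite mxE; have [ij d0|_] := eqVneq (i : nat) j;
    last by rewrite eqxx.
  by rewrite {1}ij ltn_ord.
(* E keeps the first m coordinates: D = diag_mx c *m E. *)
pose E : 'M[int]_(m, k) := \matrix_(i, j) (i == j :> nat)%:R.
exists (invmx L), (\row_i d`_i), (E *m P), (invmx P *m E^T); split.
- by rewrite unitmx_inv.
- by move=> i; rewrite mxE; case: (cn0 i).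
- rewrite mulmxA -[LHS](mulmxKV uP) LMP; congr (_ *m P).
  apply/matrixP => i j; rewrite mul_diag_mx !mxE.
  by case: (_ == _ :> nat); rewrite ?mulr1 ?mulr0.
- rewrite mulmxA mulmxK //; apply/matrixP => i j; rewrite !mxE.
  rewrite (bigD1 (Ordinal (cn0 i).1)) //= !mxE eqxx mul1r big1 ?addr0.
    by rewrite eq_sym.
  move=> l li; rewrite !mxE; case: eqP => [il|]; last by rewrite mul0r.
  by case/eqP: li; apply: val_inj.
Qed.

Section Solve.
Variables (m k : nat) (M : 'M[int]_(m, k)).
Hypothesis Minj : forall y : 'rV_m, y *m M = 0 -> y = 0.

Lemma mulmx_int_surj_field (F : numFieldType) (w : 'cV[F]_m) :
  exists b : 'cV[F]_k, map_mx intr M *m b = w.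
Proof.
have [L [c [S [T [uL c0 LM ST]]]]] := smith_full_row_rank Minj.
have MT : M *m T = invmx L *m diag_mx c.
  by rewrite -[in LHS](mulKmx uL M) LM -!mulmxA ST mulmx1.
pose v := map_mx intr L *m w.
exists (map_mx intr T *m (\col_i ((c 0 i)%:~R^-1 * v i 0))).
rewrite mulmxA -map_mxM /= MT map_mxM -mulmxA (_ : _ *m \col_i _ = v).
  by rewrite /v mulmxA -map_mxM mulVmx // map_mx1 mul1mx.
by apply/colP => i; rewrite map_diag_mx mul_diag_mx !mxE mulVKf ?intr_eq0.
Qed.

(** The finite group coker M is separated by its characters with values in
    Q / Z.  Such a character is w |-> (y w) / e, where y M is divisible by e. *)
Lemma mulmx_int_image (w : 'cV[int]_m) :
    (forall (e : int) (y : 'rV_m) (x : 'rV_k),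
      e != 0 -> y *m M = e *: x -> (e %| ((y *m w) 0 0)%R)%Z) ->
  exists x : 'cV_k, M *m x = w.
Proof.
have [L [c [S [T [uL c0 LM ST]]]]] := smith_full_row_rank Minj => wdvd.
pose v := \col_i (((L *m w) i 0)%R %/ (c 0 i)%R)%Z.
exists (T *m v); rewrite -[LHS](mulKmx uL) -[RHS](mulKmx uL); congr (_ *m _).
rewrite !mulmxA LM -!mulmxA [S *m _]mulmxA ST mul1mx.
apply/colP => i; rewrite mul_diag_mx mxE [v i 0]mxE mulrC divzK //.
have -> : (L *m w) i 0 = (row i L *m w) 0 0 by rewrite -row_mul [RHS]mxE.
(* w |-> (L w)_i / c_i is a character of coker M. *)
apply: (wdvd _ _ (row i S)) => //; rewrite -row_mul LM mul_diag_mx.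
by apply/rowP => j; rewrite !mxE.
Qed.
End Solve.

(** * Integer row vectors as functionals *)

Lemma col_sum_delta k (x : 'cV[int]_k) : x = \sum_j delta_mx j 0 *~ x j 0.
Proof.
rewrite [LHS]matrix_sum_delta; apply: eq_bigr => i _.
by rewrite big_ord1 -[x i 0]intz scaler_int intz.
Qed.

Section Forms.
Variable k : nat.

Definition row_eval (y : 'rV[int]_k) (x : 'cV[int]_k) : int := (y *m x) 0 0.

Fact row_eval_zmod_morphism y : zmod_morphism (row_eval y).
Proof. by move=> u v; rewrite /row_eval mulmxBr !mxE. Qed.

HB.instance Definition _ y :=
  GRing.isZmodMorphism.Build 'cV[int]_k int (row_eval y) (row_eval_zmod_morphism y).

Definition rowform (y : 'rV[int]_k) : HomZ 'cV[int]_k int := row_eval y.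

Fact rowform_zmod_morphism : zmod_morphism rowform.
Proof. by move=> y z; apply: HomZP => x; rewrite /= /row_eval mulmxBl !mxE. Qed.

HB.instance Definition _ :=
  GRing.isZmodMorphism.Build 'rV[int]_k (HomZ 'cV[int]_k int) rowform rowform_zmod_morphism.

Definition coords (u : HomZ 'cV[int]_k int) : 'rV[int]_k := \row_j u (delta_mx j 0).

Fact coords_zmod_morphism : zmod_morphism coords.
Proof. by move=> u v; apply/rowP => j; rewrite !mxE. Qed.

HB.instance Definition _ :=
  GRing.isZmodMorphism.Build (HomZ 'cV[int]_k int) 'rV[int]_k coords coords_zmod_morphism.

End Forms.

Section Matrix.
Variables (k m : nat) (f : {additive 'cV[int]_k -> 'cV[int]_m}).

Definition mx_of : 'M[int]_(m, k) := \matrix_(i, j) f (delta_mx j 0) i 0.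

Lemma mx_ofE x : f x = mx_of *m x.
Proof.
rewrite (col_sum_delta x) raddf_sum mulmx_sumr; apply: eq_bigr => j _.
rewrite !raddfMz /=; congr (_ *~ _).
by apply/colP => i; rewrite -colE !mxE.
Qed.

End Matrix.

Lemma coordsK k : cancel (@coords k) (@rowform k).
Proof.
move=> u; apply: HomZP => x; rewrite /= /row_eval.
rewrite [in RHS](col_sum_delta x) mxE raddf_sum; apply: eq_bigr => j _.
by rewrite raddfMz /= mxE mulrzz.
Qed.

Lemma rowformK k : cancel (@rowform k) (@coords k).
Proof. by move=> y; apply/rowP => j; rewrite !mxE /= /row_eval -colE mxE. Qed.

Lemma dual_map_rowform k m (f : {additive 'cV[int]_k -> 'cV[int]_m}) y :
  dual_map f (rowform y) = rowform (y *m mx_of f).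
Proof. by apply: HomZP => x; rewrite /= /row_eval (mx_ofE f) mulmxA. Qed.

(** * The component group of the characters of a dual cokernel *)

Section Characters.
Variables (R : realType) (k m : nat) (f : {additive 'cV[int]_k -> 'cV[int]_m}).
Local Notation M := (mx_of f).
Local Notation MR := (map_mx intr M : 'M[R]_(m, k)).
Local Notation D := {ideal_quot im_pred (dual_map f)}.
Local Notation G := (HomZ (coker (dual_map f)) (Cstar R)).

Definition dot (y : 'rV[int]_k) (a : 'cV[R]_k) : R := (map_mx intr y *m a) 0 0.

Fact dotB a : zmod_morphism (dot^~ a).
Proof. by move=> y z; rewrite /dot map_mxB mulmxBl !mxE. Qed.

Lemma dotBr y a b : dot y (a - b) = dot y a - dot y b.
Proof. by rewrite /dot mulmxBr !mxE. Qed.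

Lemma dotZr t y a : dot y (t *: a) = t * dot y a.
Proof. by rewrite /dot -scalemxAr mxE. Qed.

Lemma dot_int y (c : 'cV[int]_k) : dot y (map_mx intr c) = ((y *m c) 0 0)%:~R.
Proof. by rewrite /dot -map_mxM mxE. Qed.

Lemma dot_delta j a : dot (delta_mx 0 j) a = a j 0.
Proof. by rewrite /dot map_delta_mx -rowE mxE. Qed.

Lemma dot_mul (y : 'rV[int]_m) a :
  dot (y *m M) a = (map_mx intr y *m (MR *m a)) 0 0.
Proof. by rewrite /dot map_mxM mulmxA. Qed.

Definition row_value (chi : G) : 'rV[int]_k -> Cstar R := chi \o \pi_D \o @rowform k.

HB.instance Definition _ chi :=
  GRing.Additive.copy (row_value chi) (chi \o \pi_D \o @rowform k).

Lemma row_value_inj chi psi : row_value chi =1 row_value psi -> chi = psi.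
Proof.
move=> e; apply: HomZP => q.
have -> : q = \pi_D (rowform (coords (repr (q : D)))) by rewrite coordsK reprK.
exact: e.
Qed.

Lemma row_value_relation chi (y : 'rV_m) : row_value chi (y *m M) = 0.
Proof.
rewrite /row_value /= -dual_map_rowform (_ : \pi_D _ = 0) ?raddf0 //.
by apply/quot_eq0/asboolP; exists (rowform y).
Qed.

(** The columns a and b form the logarithm of chi: chi is the character
    y |-> exp (y a + 2 i pi y b). *)
Definition is_log (chi : G) (a b : 'cV[R]_k) :=
  forall y, row_value chi y = Exp (dot y a, dot y b).

Lemma log_exists chi : exists a b, is_log chi a b.
Proof.
have /choice[z zE] j := Exp_surj (row_value chi (delta_mx 0 j)).
exists (\col_j (z j).1), (\col_j (z j).2) => y.
have yE : y = \sum_j delta_mx 0 j *~ y 0 j.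
  rewrite [LHS]matrix_sum_delta big_ord1; apply: eq_bigr => j _.
  by rewrite -[y 0 j]intz scaler_int intz.
have dE (a : 'cV[R]_k) : dot y a = \sum_j a j 0 *~ y 0 j.
  by rewrite /dot mxE; apply: eq_bigr => j _; rewrite mxE mulrC mulrzr.
rewrite !dE {1}yE raddf_sum.
under eq_bigr => j _ do rewrite raddfMz /= -zE -raddfMz.
rewrite -raddf_sum; congr Exp; rewrite [LHS]surjective_pairing !raddf_sum /=.
by congr (_, _); apply: eq_bigr => j _; rewrite !raddfMz mxE.
Qed.

(** Characters of the cokernel are trivial on the rows of M. *)
Lemma log_relation chi a b : is_log chi a b ->
  MR *m a = 0 /\ exists w : 'cV_m, MR *m b = map_mx intr w.
Proof.
move=> ab.
have ri i : (MR *m a) i 0 = 0 /\ (MR *m b) i 0 \is a Num.int.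
  have /Exp_eq0 /= := etrans (esym (ab _)) (row_value_relation chi (delta_mx 0 i)).
  by rewrite !dot_mul map_delta_mx -!rowE !mxE.
split; first by apply/colP => i; rewrite (ri i).1 mxE.
have /choice[w wE] i : exists n : int, (MR *m b) i 0 = n%:~R.
  by apply/intrP; case: (ri i).
by exists (\col_i w i); apply/colP => i; rewrite wE !mxE.
Qed.

Lemma char_exists a b w : MR *m a = 0 -> MR *m b = map_mx intr w ->
  exists chi, is_log chi a b.
Proof.
move=> Ma Mb.
pose g (u : HomZ 'cV[int]_k int) := Exp (dot (coords u) a, dot (coords u) b).
have gB : zmod_morphism g.
  by move=> u v; rewrite /g raddfB /= !dotB -raddfB; congr Exp.
pose gA : {additive HomZ 'cV[int]_k int -> Cstar R} :=
  HB.pack g (GRing.isZmodMorphism.Build _ _ g gB).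
have [|h hE] := @quot_lift _ _ (im_pred (dual_map f)) gA.
  move=> _ /asboolP[u <-]; rewrite /= /g -[u]coordsK dual_map_rowform rowformK.
  apply/Exp_eq0; rewrite /= !dot_mul Ma mulmx0 mxE Mb -map_mxM mxE.
  by split=> //; exact: intr_int.
by exists h => y; rewrite /row_value /= hE /= /g rowformK.
Qed.

Lemma log_unique chi a b a' b' : is_log chi a b -> is_log chi a' b' ->
  exists c, b' = b + map_mx intr c.
Proof.
move=> ab ab'.
have bi j : b' j 0 - b j 0 \is a Num.int.
  have : Exp (a' j 0 - a j 0, b' j 0 - b j 0) = 0.
    rewrite (_ : (_, _) = (a' j 0, b' j 0) - (a j 0, b j 0)) // raddfB /=.
    by apply/eqP; rewrite subr_eq0 -!dot_delta -ab -ab'.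
  by case/Exp_eq0.
have /choice[c cE] j := elimT intrP (bi j).
by exists (\col_j c j); apply/colP => j; rewrite !mxE -cE addrC subrK.
Qed.

Lemma logB chi psi a b a' b' : is_log chi a b -> is_log psi a' b' ->
  is_log (chi - psi) (a - a') (b - b').
Proof.
move=> ab ab' y; rewrite !dotBr.
rewrite (_ : (_, _) = (dot y a, dot y b) - (dot y a', dot y b')) // raddfB /=.
by rewrite -ab -ab'.
Qed.

(** The topology of G is that of pointwise convergence, so only the evaluations
    at the classes of rows matter, and these are exponentials of lines. *)
Lemma log_path_continuous (chi : R -> G) a b :
  (forall t, is_log (chi t) (t *: a) (t *: b)) -> continuous chi.
Proof.
move=> chiE; apply: continuous_comp_initial => t.
have FF : Filter ((fun s => (chi s : coker (dual_map f) -> Cstar R)) @ t).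
  by exact: fmap_filter.
apply/cvg_sup => q; move: t {FF}.
apply/(@continuousP _ (initial_topology (@^~ q))) => _ [C oC <-].
pose y := coords (repr (q : D)).
have qE : q = \pi_D (rowform y) by rewrite coordsK reprK.
suff /continuousP : continuous (fun t => chi t q) by exact.
rewrite (_ : (fun t => _) = fun t => Exp (t * dot y a, t * dot y b)).
  exact: (@Exp_path_continuous R (dot y a, dot y b)).
by apply/funext => t; rewrite -!dotZr -chiE qE.
Qed.

Local Notation C := {ideal_quot im_pred f}.

(** The map sends chi to the class of the integral vector M b.  It is well
    defined since b is unique up to an integral column c, which changes M b by
    the element M c of the image of f. *)
Lemma component_map_exists :
  exists F : {additive G -> coker f}, forall chi a b w,
    is_log chi a b -> MR *m b = map_mx intr w -> F chi = \pi_C w.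
Proof.
have /choice[F FE] (chi : G) : exists c : coker f, forall a b w,
    is_log chi a b -> MR *m b = map_mx intr w -> c = \pi_C w.
  have [a [b ab]] := log_exists chi; have [_ [w wE]] := log_relation ab.
  exists (\pi_C w) => a' b' w' ab' wE'; have [c cE] := log_unique ab ab'.
  apply/eqP; rewrite eq_sym -subr_eq0 -raddfB; apply/eqP/quot_eq0/asboolP.
  exists c; rewrite mx_ofE; apply/colP => i; apply: (@intr_inj R).
  move/colP/(_ i): wE'; rewrite cE mulmxDr wE -map_mxM !mxE => wE'.
  by rewrite intrB -wE'; ring.
have FB : zmod_morphism F.
  move=> chi psi.
  have [a [b ab]] := log_exists chi; have [_ [w wE]] := log_relation ab.
  have [a' [b' ab']] := log_exists psi; have [_ [w' wE']] := log_relation ab'.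
  rewrite (FE _ _ _ _ ab wE) (FE _ _ _ _ ab' wE') -raddfB.
  by apply: (FE _ _ _ _ (logB ab ab')); rewrite mulmxBr wE wE' map_mxB.
pose FA : {additive G -> coker f} := HB.pack F (GRing.isZmodMorphism.Build _ _ F FB).
by exists FA.
Qed.

Hypothesis Minj : forall y : 'rV_m, y *m M = 0 -> y = 0.

Section ComponentMap.
Variables (F : {additive G -> coker f}).
Hypothesis FE : forall chi a b w,
    is_log chi a b -> MR *m b = map_mx intr w -> F chi = \pi_C w.

Lemma component_map_surj c : exists chi, F chi = c.
Proof.
have [b bE] := mulmx_int_surj_field Minj (map_mx intr (repr (c : C)) : 'cV[R]_m).
have [chi chiE] := char_exists (mulmx0 _ _) bE.
by exists chi; rewrite (FE chiE bE) reprK.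
Qed.

(** A character in the kernel has a logarithm annihilated by M; scaling this
    logarithm joins chi to the trivial character inside G. *)
Lemma component_map_ker chi : F chi = 0 -> chi \in @id_component G.
Proof.
have [a [b ab]] := log_exists chi; have [Ma [w wE]] := log_relation ab.
rewrite (FE ab wE) => /quot_eq0/asboolP[x xE].
(* An integral shift of b does not change chi. *)
pose b' := b - map_mx intr x.
have Mb' : MR *m b' = 0.
  by rewrite mulmxBr wE -map_mxM -mx_ofE xE subrr.
have ab' : is_log chi a b'.
  move=> y; rewrite ab dotBr dot_int; apply/eqP; rewrite -subr_eq0 -raddfB.
  apply/eqP/Exp_eq0; rewrite /= subrr opprD addNKr opprK.
  by split=> //; exact: intr_int.
have /choice[path pathE] t : exists psi, is_log psi (t *: a) (t *: b').
  by apply: (@char_exists _ _ 0); rewrite -scalemxAr ?Ma ?Mb' scaler0 ?map_mx0.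
have path0 : path 0 = 0.
  apply: row_value_inj => y; rewrite pathE !scale0r /dot mulmx0 mxE.
  exact: (@raddf0 _ _ (@Exp R : {additive _ -> _})).
have path1 : path 1 = chi.
  by apply: row_value_inj => y; rewrite pathE !scale1r ab'.
apply/asboolP.
have cpath : connected (path @` `[0, 1]).
  apply: connected_continuous_connected; first exact: segment_connected.
  exact/continuous_subspaceT/(log_path_continuous pathE).
apply: (connected_component_max _ _ cpath) => //.
  by exists 0; rewrite //= in_itv /= lexx ler01.
by exists 1; rewrite //= in_itv /= lexx ler01.
Qed.

(** Characters in the identity component are trivial on the torsion of the
    cokernel, since they take values in a finite group there.  This suffices
    by the criterion mulmx_int_image. *)
Lemma id_component_ker chi : chi \in @id_component G -> F chi = 0.
Proof.
have [a [b ab]] := log_exists chi; have [Ma [w wE]] := log_relation ab.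
move=> /asboolP chi0; rewrite (FE ab wE); apply/quot_eq0/asboolP.
have [e y x e0 yM|x xE] := @mulmx_int_image _ _ _ Minj w; last first.
  by exists x; rewrite mx_ofE.
(* Here e x = y M, so x represents a torsion class. *)
suff evx : row_value chi x = 0.
  have := ab x; rewrite evx => /esym/Exp_eq0 /= [_ /intrP[c cE]].
  apply/dvdzP; exists c; apply: (@intr_inj R).
  have := dot_mul y b; rewrite yM wE -map_mxM.
  rewrite [RHS]mxE => <-.
  by rewrite rmorphM /= -cE mulrC /dot map_mxZ -scalemxAl mxE.
have ev_tors psi : row_value psi x *+ `|e|%N = 0.
  have : row_value psi (x *~ e) = 0 by rewrite -scaler_int intz -yM row_value_relation.
  rewrite raddfMz => ex.
  by case: (e) ex => n //; rewrite NegzE mulrNz => /eqP; rewrite oppr_eq0 => /eqP.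
pose A := (fun psi : G => row_value psi x) @` connected_component [set: G] 0.
apply: (@connected_torsion_Cstar _ A `|e|%N); rewrite ?absz_gt0 //.
- apply: connected_continuous_connected; first exact: component_connected.
  exact/continuous_subspaceT/HomZ_eval_continuous.
- by exists 0 => //; exact: connected_component_refl.
- by exists chi.
- by move=> _ [psi _ <-].
Qed.

End ComponentMap.

(** Linear independence of the rows of M amounts to coker f being finite.  It
    cannot be dropped: for f = 0 on Z, the characters form the connected group
    C^*, although coker f = Z. *)
Theorem component_group_coker : zmod_isog (component_group G) (coker f).
Proof.
have [F FE] := component_map_exists.
apply: (@quot_isog _ _ _ F); first exact: component_map_surj FE.
move=> chi; split; [exact: component_map_ker FE chi|exact: id_component_ker FE chi].
Qed.

End Characters.

(** * Functionals on N and the span of the rays *)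

HB.instance Definition _ (R : nzRingType) (K : choiceType) (V : lmodType R)
    (g : K -> V) :=
  GRing.isZmodMorphism.Build {freeg K / R} V (fglift g) (lift_is_additive g).

Lemma fglift_scale (R : nzRingType) (K : choiceType) (V : lmodType R) (g : K -> V)
    c (D : {freeg K / R}) :
  fglift g (c *: D) = c *: fglift g D.
Proof.
have -> : c *: D = \sum_(x <- dom D) << c * coeff x D *g x >> by [].
rewrite -[in RHS](freeg_sumE D) !raddf_sum.
by apply: eq_bigr => x _; rewrite /= !liftU scalerA.
Qed.

Section RealExtension.
Variables (R : realType) (N : zmodType).

(** An integer functional on N extends to an R-linear functional on N (x) R:
    extend it to the free module on N and pass to the quotient. *)
Lemma realext_extend (psi : {additive N -> int}) :
  exists L : {additive realext R N -> R},
    (forall a, L (tens1 R a) = (psi a)%:~R) /\ (forall r x, L (r *: x) = r * L x).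
Proof.
pose g : N -> R^o := fun a => (psi a)%:~R.
have [|L LE] := @quot_lift _ _ (@tensor_rel R N) (fglift g).
  move=> _ /asboolP[k [c [a [b ->]]]]; rewrite raddf_sum big1 // => i _.
  rewrite /= fglift_scale !raddfB /= !liftU !scale1r /g raddfD /= intrD.
  by rewrite scalerDr -addrA -opprD subrr.
exists L; split=> [a|r]; first by rewrite LE /= liftU scale1r.
elim/realext_ind => E; rewrite [_ *: _]realext_piZ !LE /=; exact: fglift_scale.
Qed.

(** The linear extension of psi vanishes on the rays, hence on their span
    N (x) R, which contains the elements a (x) 1. *)
Lemma span_separates (n : nat) (v : 'I_n -> N) (psi : {additive N -> int}) :
    lin_span (\bigcup_j half_line (tens1 R (v j))) = setT ->
    (forall j, psi (v j) = 0) ->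
  forall a, psi a = 0.
Proof.
move=> spanv psiv a; have [L [L1 LZ]] := realext_extend psi.
apply: (@intr_inj R); rewrite -L1.
have : lin_span (\bigcup_j half_line (tens1 R (v j))) (tens1 R a) by rewrite spanv.
move=> [k [c [x [xv ->]]]]; rewrite raddf_sum big1 // => i _.
have [j _ [r _ <-]] := xv i.
by rewrite /= !LZ L1 psiv !mulr0.
Qed.

End RealExtension.

(** * The cokernel of [B Q] *)

Section Resolution.
Variables (N : zmodType) (n m l : nat).
Variables (beta : {additive 'cV[int]_n -> N}).
Variables (Q : {additive 'cV[int]_l -> 'cV[int]_m}) (p : {additive 'cV[int]_m -> N}).
Hypothesis Hres : free_resolution Q p.
Variables (B : {additive 'cV[int]_n -> 'cV[int]_m}).
Hypothesis Hlift : forall x, p (B x) = beta x.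

Lemma BQ_image x : (exists u, BQ B Q u = x) <-> exists v, beta v = p x.
Proof.
split=> [[u <-]|[v vE]].
  exists (usubmx u); rewrite /BQ raddfD /= Hlift.
  by rewrite ((resolution_exact Hres _).2 _) ?addr0 //; exists (dsubmx u).
have /(resolution_exact Hres)[w wE] : p (x - B v) = 0 by rewrite raddfB /= Hlift vE subrr.
by exists (col_mx v w); rewrite /BQ col_mxKu col_mxKd wE addrC subrK.
Qed.

(** The projection p is onto N, and the preimage of the image of beta is the
    image of [B Q]. *)
Lemma coker_BQ_isog : zmod_isog (coker (BQ B Q)) (coker beta).
Proof.
apply: (@quot_isog _ _ _ (\pi_{ideal_quot im_pred beta} \o p)) => [c|x].
  have [x xE] := resolution_surj Hres (repr (c : {ideal_quot im_pred beta})).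
  by exists x; rewrite /= xE reprK.
apply: (iff_trans (quot_eq0 _ _)).
by split=> /asboolP/BQ_image/asboolP.
Qed.

Lemma descend_functional (u : {additive 'cV[int]_m -> int}) :
    (forall x, u (Q x) = 0) ->
  exists psi : {additive N -> int}, forall x, psi (p x) = u x.
Proof.
move=> uQ; have /choice[s sE] := resolution_surj Hres.
have up x y : p x = p y -> u x = u y.
  move=> pxy; apply/eqP; rewrite -subr_eq0 -raddfB.
  have /(resolution_exact Hres)[w <-] : p (x - y) = 0 by rewrite raddfB pxy subrr.
  by rewrite uQ.
have psiB : zmod_morphism (u \o s).
  by move=> a b; rewrite /= -raddfB; apply: up; rewrite raddfB !sE.
pose psi : {additive N -> int} := HB.pack (u \o s) (GRing.isZmodMorphism.Build _ _ _ psiB).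
by exists psi => x; apply: up; rewrite sE.
Qed.

(** A row y with y M = 0 vanishes on the image of Q, which is the kernel of p,
    so it descends to a functional on N; this functional vanishes on the image
    of beta, hence is zero by hypothesis. *)
Lemma BQ_full_row_rank :
    (forall psi : {additive N -> int},
      (forall j, psi (beta (std_basis j)) = 0) -> forall a, psi a = 0) ->
  forall y : 'rV_m, y *m mx_of (BQ B Q) = 0 -> y = 0.
Proof.
move=> sep y yM.
have yBQ x : row_eval y (BQ B Q x) = 0.
  by rewrite /row_eval (mx_ofE (BQ B Q)) mulmxA yM mul0mx mxE.
have yB x : row_eval y (B x) = 0.
  by have := yBQ (col_mx x 0); rewrite /BQ col_mxKu col_mxKd raddf0 addr0.
have yQ x : row_eval y (Q x) = 0.
  by have := yBQ (col_mx 0 x); rewrite /BQ col_mxKu col_mxKd raddf0 add0r.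
have [psi psiE] := descend_functional yQ.
have psi0 : forall a, psi a = 0.
  by apply: sep => j; rewrite -Hlift psiE /= yB.
by apply/rowP => i; rewrite mxE -[y]rowformK mxE -[RHS](psi0 (p (delta_mx i 0))) psiE.
Qed.

End Resolution.

Theorem lemma2p8 (R : realType) (d n l : nat) (N : zmodType)
    (Sigma : set (set (realext R N))) (rho : 'I_n -> set (realext R N))
    (beta : {additive 'cV[int]_n -> N})
    (Hfan : stacky_fan d Sigma rho beta)
    (Q : {additive 'cV[int]_l -> 'cV[int]_(d + l)})
    (p : {additive 'cV[int]_(d + l) -> N})
    (Hres : free_resolution Q p)
    (B : {additive 'cV[int]_n -> 'cV[int]_(d + l)})
    (Hlift : forall x, p (B x) = beta x) :
  let G := HomZ (DG B Q) (Cstar R) in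
  zmod_isog (component_group G) (coker beta) /\
  (connected [set: G] <-> (forall a : N, exists x, beta x = a)).
Proof.
move=> G.
have full : forall y : 'rV_(d + l), y *m mx_of (BQ B Q) = 0 -> y = 0.
  apply: (BQ_full_row_rank Hres Hlift) => psi; apply: (@span_separates R).
  rewrite -(stacky_span Hfan); congr lin_span; apply: eq_bigcupr => j _.
  by rewrite (stacky_beta Hfan).
have isog : zmod_isog (component_group G) (coker beta).
  exact: zmod_isog_trans (component_group_coker R full) (coker_BQ_isog Hres Hlift).
split=> //.
exact: iff_trans (connected_component_group G)
  (iff_trans (zmod_isog_eq0 isog) (coker_eq0 beta)).
Qed.
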